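(* Let $\mathcal G$ be a class of graphs. Then there exist integers $d,m$ such that $\mathcal G\subseteq\mathrm{TM}_d^m$ if and only if there exists an integer $k$ such that $\mathcal G\subseteq\mathrm{SC}_k$. More precisely, for all non-negative integers $d,m,k$: $\mathrm{TM}_d^m\subseteq \mathrm{SC}_{dm(m+1)}$ and $\mathrm{SC}_k\subseteq\mathrm{TM}_k^{2^k}$.
   Context: All graphs are finite, simple and undirected. A tree-model of $m$ colours and depth $d$ of a graph $G$ is a rooted tree $T$ with a set $S\subseteq\{1,\dots,m\}^2\times\{1,\dots,d\}$ such that: every root-to-leaf path of $T$ has length exactly $d$; the leaves of $T$ are exactly $V(G)$; each leaf gets one of the colours $1,\dots,m$; $(i,j,\ell)\in S$ iff $(j,i,\ell)\in S$; and for distinct $u,v\in V(G)$ coloured $i,j$ at distance $2\ell$ in $T$, $uv\in E(G)$ iff $(i,j,\ell)\in S$. $\mathrm{TM}_d^m$ is the class of graphs having such a tree-model. For a graph $G$ and $X\subseteq V(G)$, $\overline{G}^X$ is the graph on $V(G)$ in which distinct $x,y$ are adjacent iff either $xy\in E(G)$ and $\{x,y\}\not\subseteq X$, or $xy\notin E(G)$ and $\{x,y\}\subseteq X$. The classes $\mathrm{SC}_n$ are defined inductively: $\mathrm{SC}_0=\{K_1\}$; if $G_1,\dots,G_p\in\mathrm{SC}_n$ ($p\ge1$), $H$ is their disjoint union, and $X\subseteq V(H)$, then $\overline{H}^X\in\mathrm{SC}_{n+1}$. *)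

(* Defs.v *)
From HB Require Import structures.
From mathcomp Require Import all_boot.

Set Implicit Arguments.
Unset Strict Implicit.
Unset Printing Implicit Defensive.

Record sgraph := SGraph {
  vertex :> finType;
  adj : rel vertex;
  adj_sym : symmetric adj;
  adj_irrefl : irreflexive adj }.

Definition isomorphic (G H : sgraph) : Prop :=
  exists2 f : G -> H, bijective f & forall x y, adj (f x) (f y) = adj x y.

Definition degree (G : sgraph) (x : G) : nat := #|[set y | adj x y]|.

Definition walk (G : sgraph) (x y : G) (p : seq G) : bool :=
  path (@adj G) x p && (last x p == y).

Definition at_distance (G : sgraph) (x y : G) (n : nat) : Prop :=
  (exists2 p, walk x y p & size p = n) /\
  (forall p, walk x y p -> n <= size p).

Definition connected (G : sgraph) : Prop :=
  forall x y : G, connect (@adj G) x y.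

Definition acyclic (G : sgraph) : Prop :=
  forall c : seq G, 2 < size c -> ~ ucycle (@adj G) c.

Definition is_tree (G : sgraph) : Prop := connected G /\ acyclic G.

(* The nodes without children: a root of degree 1 is not a leaf, whereas the
   root of the one-node tree is. *)
Definition is_leaf (T : sgraph) (root x : T) : bool :=
  if x == root then degree x == 0 else degree x == 1.

(* The leaves are identified with V(G) through [leaf].  Colours 1..m are
   represented by 'I_m and levels 1..d by 'I_d, so that l : 'I_d stands for
   the level l.+1. *)
Record tree_model (d m : nat) (G : sgraph) := TreeModel {
  tm_tree : sgraph;
  tm_root : tm_tree;
  tm_sig : {set 'I_m * 'I_m * 'I_d};
  tm_leaf : G -> tm_tree;
  tm_color : G -> 'I_m;
  tm_treeP : is_tree tm_tree;
  tm_depth : forall p : seq tm_tree,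
    path (@adj tm_tree) tm_root p -> uniq (tm_root :: p) ->
    is_leaf tm_root (last tm_root p) -> size p = d;
  tm_leaf_inj : injective tm_leaf;
  tm_leafP : forall t, is_leaf tm_root t <-> exists v, tm_leaf v = t;
  tm_sig_sym : forall i j l, ((i, j, l) \in tm_sig) = ((j, i, l) \in tm_sig);
  tm_adj : forall (u v : G) (l : 'I_d), u != v ->
    at_distance (tm_leaf u) (tm_leaf v) (2 * l.+1) ->
    adj u v = ((tm_color u, tm_color v, l) \in tm_sig) }.

Definition TM (d m : nat) (G : sgraph) : Prop := inhabited (tree_model d m G).

Section SubsetComplement.
Variables (G : sgraph) (X : {set G}).

Definition compl_adj : rel G := fun x y =>
  (x != y) &&
  ((adj x y && ~~ ([set x; y] \subset X)) ||
   (~~ adj x y && ([set x; y] \subset X))).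

Lemma compl_adj_sym : symmetric compl_adj.
Proof. by move=> x y; rewrite /compl_adj eq_sym adj_sym setUC. Qed.

Lemma compl_adj_irrefl : irreflexive compl_adj.
Proof. by move=> x; rewrite /compl_adj eqxx. Qed.

Definition subset_compl : sgraph := SGraph compl_adj_sym compl_adj_irrefl.
End SubsetComplement.

Section DisjointUnion.
Variables (p : nat) (Gs : 'I_p -> sgraph).

Definition dunion_vertex : finType := {i : 'I_p & Gs i}.

(* [tagged_as x y] is [tagged y] transported to the component of x. *)
Definition dunion_adj : rel dunion_vertex := fun x y =>
  (tag x == tag y) && adj (tagged x) (tagged_as x y).

Lemma dunion_adj_sym : symmetric dunion_adj.
Proof.
move=> [i x] [j y]; rewrite /dunion_adj /= [j == i]eq_sym.
case: (i =P j) y => [<- y | //].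
by rewrite !tagged_asE /= adj_sym.
Qed.

Lemma dunion_adj_irrefl : irreflexive dunion_adj.
Proof. by move=> [i x]; rewrite /dunion_adj /= tagged_asE adj_irrefl andbF. Qed.

Definition dunion : sgraph := SGraph dunion_adj_sym dunion_adj_irrefl.
End DisjointUnion.

Definition K1 : sgraph :=
  @SGraph unit (fun _ _ => false) (fun _ _ => erefl) (fun _ => erefl).

(* Graph classes are closed under isomorphism. *)
Inductive SC : nat -> sgraph -> Prop :=
| SC_base (G : sgraph) : isomorphic G K1 -> SC 0 G
| SC_step (n p : nat) (Gs : 'I_p -> sgraph) (X : {set dunion Gs}) (G : sgraph) :
    0 < p -> (forall i, SC n (Gs i)) ->
    isomorphic G (subset_compl X) -> SC n.+1 G.

(* Main.v *)
(** Both classes amount to an ultrametric [lev] on the vertices with values in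
    [0..d], together with a colouring such that the adjacency of two distinct
    vertices depends only on their colours and on [lev].

    In a tree-model, [lev u v] is half the distance of the leaves.  Conversely,
    the balls of an ultrametric, ordered by inclusion and tagged with their radius,
    form a tree.

    For TM in SC, induct on [d]: a symmetric relation on [m] colours is, over
    GF(2), a sum of at most [m (m + 1)] relations "both in [Y]", so the edges
    between the classes [lev <= d] are produced by [m (m + 1)] successive
    subset complementations.  For SC in TM, let [lev x y] be the step at which
    [x] and [y] first lie in a common component, and colour [x] by the vector of
    the steps whose complemented set contains [x]. *)

Require Import Defs.
From mathcomp Require Import all_boot zify.

Set Implicit Arguments.
Unset Strict Implicit.
Unset Printing Implicit Defensive.

(** * Unique paths in acyclic graphs *)

Section UniquePaths.
Variable G : sgraph.
Implicit Types (x y z : G) (p q : seq G).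

Lemma walk_rev x y p : walk x y p -> walk y x (rev (belast x p)).
Proof.
case/andP=> pth /eqP <-; rewrite /walk -(eq_path (fun u v => adj_sym v u)).
rewrite -rev_path in pth; rewrite pth /=.
by case: p {pth} => //= a p; rewrite rev_cons last_rcons.
Qed.

Lemma walk_cat x y z p q : walk x y p -> walk y z q -> walk x z (p ++ q).
Proof.
case/andP=> pth1 /eqP e1 /andP[pth2 /eqP e2].
by rewrite /walk cat_path last_cat e1 pth1 pth2 e2 eqxx.
Qed.

Lemma acyclic_uniq_path x y p q : acyclic G ->
  walk x y p -> walk x y q -> uniq (x :: p) -> uniq (x :: q) -> p = q.
Proof.
move=> acG; elim: p x q => [|a p IH] x [|b q] //.
- move=> /andP[_ /eqP /= <-] /andP[_ /eqP /= e] _ /andP[xq _].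
  by rewrite -[X in X \in _]e mem_last in xq.
- move=> /andP[_ /eqP /= <-] /andP[_ /eqP /= e] /andP[xq _] _.
  by rewrite e mem_last in xq.
move=> wp wq /= /andP[xp up] /andP[xq uq].
case/andP: (wp) => /= /andP[xa pp] ep; case/andP: (wq) => /= /andP[xb pq] eq.
have wp' : walk a y p by rewrite /walk pp.
have wq' : walk b y q by rewrite /walk pq.
case: (eqVneq a b) => [eab | nab].
  by rewrite -eab in wq' uq *; rewrite (IH a q).
(* Two distinct first steps close up, through the end point, to a cycle at x. *)
have /andP[pth /eqP lst] := walk_cat wp' (walk_rev wq').
case: (shortenP pth) lst => r pr ur sr lr.
exfalso; apply: (acG [:: x, a & r]).
  by case: r lr {pr ur sr} => //= e; rewrite e eqxx in nab.
rewrite /ucycle cons_uniq ur /= xa rcons_path pr lr adj_sym xb /= andbT.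
rewrite inE negb_or.
move: xp xq; rewrite !inE !negb_or => /andP[-> xp] xq /=.
apply/negP => /sr; rewrite mem_cat (negPf xp) mem_rev /= => /mem_belast.
by rewrite inE (negPf (proj1 (andP xq))) (negPf (proj2 (andP xq))).
Qed.

(** Any walk shortens to a duplicate-free one, and by uniqueness that one is [p]. *)
Lemma uniq_walk_distance x y p : acyclic G ->
  walk x y p -> uniq (x :: p) -> at_distance x y (size p).
Proof.
move=> acG wp up; split; first by exists p.
move=> q /andP[pq /eqP]; case: (shortenP pq) => r pr ur sr lr.
have /(_ r) -> // := acyclic_uniq_path acG wp _ up; last first.
  by rewrite /walk pr lr eqxx.
by apply: uniq_leq_size => //; case/andP: ur.
Qed.

(** Here [x] acts as the root: an end point that is not a leaf has a neighbour besides its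
    predecessor on the path, and acyclicity makes that neighbour new. *)
Lemma extend_uniq_path x p : acyclic G -> path (@adj G) x p -> uniq (x :: p) ->
  ~~ is_leaf x (last x p) ->
  exists y, path (@adj G) x (rcons p y) && uniq (x :: rcons p y).
Proof.
move=> acG pp up; set z := last x p => zleaf.
have [y zy ynew] : exists2 y, adj z y & y \notin x :: p; last first.
  by exists y; rewrite rcons_path pp -/z zy -rcons_cons rcons_uniq ynew.
case/lastP: p @z pp up zleaf => [|q z] /=.
  move=> _ _; rewrite /is_leaf eqxx /degree cards_eq0 => /set0Pn[y].
  rewrite inE => xy; exists y; rewrite // inE.
  by apply: contraTneq xy => ->; rewrite adj_irrefl.
rewrite last_rcons rcons_path => /andP[pq wz] uq.
have zx : z != x.
  by case/andP: uq; rewrite mem_rcons inE negb_or eq_sym => /andP[].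
rewrite /is_leaf (negPf zx) /degree => dz.
have [y zy yw] : exists2 y, adj z y & y != last x q.
  have : [set y | adj z y] :\ (last x q) != set0.
    rewrite -card_gt0; rewrite (cardsD1 (last x q)) inE adj_sym wz in dz.
    by case: #|_| dz.
  by case/set0Pn=> y; rewrite !inE => /andP[? ?]; exists y.
exists y => //; rewrite -rcons_cons mem_rcons inE negb_or.
apply/andP; split; first by apply: contraTneq zy => ->; rewrite adj_irrefl.
(* If [y] were on the path already, the edge from [y] to [z] would give a second path from [x] to
   [z]; uniqueness then makes [y] the predecessor of [z]. *)
apply/negP => /splitPl yq; case: q / yq pq wz uq yw => q1 q2 ly pq wz uq yw.
have : rcons q1 z = rcons (q1 ++ q2) z.
  apply: (@acyclic_uniq_path x z) => //.
  - rewrite /walk rcons_path last_rcons eqxx ly adj_sym zy !andbT.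
    by move: pq; rewrite cat_path => /andP[].
  - by rewrite /walk rcons_path last_rcons eqxx pq wz.
  apply: subseq_uniq (uq : uniq (x :: _)); rewrite /= eqxx -!cats1 -catA.
  by apply: cat_subseq => //; apply: suffix_subseq.
move/rcons_inj => [/(congr1 size)]; rewrite size_cat => /eqP.
rewrite -{1}[size q1]addn0 eqn_add2l eq_sym => /nilP q20.
by rewrite q20 cats0 ly eqxx in yw.
Qed.

(** Without leaves, duplicate-free paths from [x] could be extended beyond the number of
    vertices. *)
Lemma tree_has_leaf x : is_tree G -> exists y, is_leaf x y.
Proof.
move=> [_ acG]; case: (pickP (is_leaf x)) => [y ? | noleaf]; first by exists y.
have long n : exists p, [&& path (@adj G) x p, uniq (x :: p) & size p == n].
  elim: n => [|n [p /and3P[pp up /eqP sp]]]; first by exists [::].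
  have [|y /andP[py uy]] := extend_uniq_path acG pp up; first by rewrite noleaf.
  by exists (rcons p y); rewrite py uy size_rcons sp eqxx.
have [p /and3P[_ up /eqP sp]] := long #|G|.
by have := max_card (mem (x :: p)); rewrite (card_uniqP up) /= sp ltnn.
Qed.
End UniquePaths.

(** * From tree-models to ultrametrics *)

Definition ultrametric (T : eqType) (d : nat) (lev : T -> T -> nat) : Prop :=
  [/\ forall x y, (lev x y == 0) = (x == y),
      forall x y, lev x y = lev y x,
      forall x y z, lev x z <= maxn (lev x y) (lev y z)
    & forall x y, lev x y <= d].

Definition level_model (d m : nat) (G : sgraph) : Prop :=
  exists (lev : G -> G -> nat) (c : G -> 'I_m) (S : 'I_m -> 'I_m -> nat -> bool),
  [/\ ultrametric d lev, forall i j l, S i j l = S j i l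
    & forall x y, x != y -> adj x y = S (c x) (c y) (lev x y)].

(** Think of [anc l x] as the ancestor of [x] at height [l]. Ancestors that agree once agree from
    then on, so the first level of agreement is an ultrametric. *)
Lemma nested_ultrametric (T U : eqType) (d : nat) (anc : nat -> T -> U) :
  injective (anc 0) -> (forall x y, anc d x = anc d y) ->
  (forall l x y, l < d -> anc l x = anc l y -> anc l.+1 x = anc l.+1 y) ->
  exists2 lev, ultrametric d lev &
    forall x y l, l <= d -> (lev x y <= l) = (anc l x == anc l y).
Proof.
move=> inj0 cstd mono.
(* If no level below [d] agrees, [find] returns [d], the right value because [anc d] is constant. *)
pose lev x y := find (fun l => anc l x == anc l y) (iota 0 d).
have levd x y : lev x y <= d by rewrite -[X in _ <= X](size_iota 0 d) find_size.
have monoD n l x y : l + n <= d ->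
    anc l x = anc l y -> anc (l + n) x = anc (l + n) y.
  elim: n => [|n IH]; first by rewrite addn0.
  by rewrite addnS => ln e; apply: mono => //; apply: IH => //; apply: ltnW.
have levP x y l : l <= d -> (lev x y <= l) = (anc l x == anc l y).
  rewrite leq_eqVlt => /orP[/eqP -> | ld]; first by rewrite levd (cstd x y) eqxx.
  apply/idP/eqP => [le | e].
    have hs : has (fun l => anc l x == anc l y) (iota 0 d).
      by rewrite has_find size_iota; apply: leq_ltn_trans ld.
    have := nth_find 0 hs; rewrite nth_iota ?add0n; last by apply: leq_ltn_trans ld.
    move/eqP => e; rewrite -(subnKC le); apply: monoD => //.
    by rewrite subnKC // ltnW.
  rewrite leqNgt; apply/negP => lt; have := before_find 0 lt.
  by rewrite nth_iota // add0n e eqxx.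
exists lev => //; split=> // [x y | x y | x y z].
- by rewrite -leqn0 levP // (inj_eq inj0).
- by rewrite /lev; apply: eq_find => l; rewrite eq_sym.
have md : maxn (lev x y) (lev y z) <= d by rewrite geq_max !levd.
rewrite levP //; apply/eqP; transitivity (anc (maxn (lev x y) (lev y z)) y).
  by apply/eqP; rewrite -levP // leq_maxl.
by apply/eqP; rewrite -levP // leq_maxr.
Qed.

Lemma last_take_nth (T : Type) (x : T) (p : seq T) (i : nat) :
  i <= size p -> last x (take i p) = nth x (x :: p) i.
Proof.
move=> ip; rewrite (last_nth x) size_takel //.
by rewrite -[x :: take i p]/(take i.+1 (x :: p)) nth_take.
Qed.

Lemma TM_nonempty (d m : nat) (G : sgraph) : TM d m G -> exists x : G, true.
Proof.
case=> M; have [t] := tree_has_leaf (tm_root M) (tm_treeP M).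
by move/tm_leafP => [v _]; exists v.
Qed.

(** The ancestors of a leaf are read off its path [P u] from the root, which has length [d]; the
    level of two leaves is the height of their lowest common ancestor. *)
Lemma TM_level_model (d m : nat) (G : sgraph) : TM d m G -> level_model d m G.
Proof.
case=> -[T root sig leaf c [cT acT] depth leaf_inj leafP sig_sym adjP].
have /fin_all_exists[P HP] u : exists p, [/\ path (@adj T) root p,
    uniq (root :: p), last root p = leaf u & size p = d].
  have /connectP[p0 pp0 e] := cT root (leaf u).
  case: (shortenP pp0) e => p pp up _ e; exists p; split=> //.
  by apply: depth => //; rewrite -e; apply/leafP; exists u.
(* Root paths through a common vertex coincide up to it. Hence a vertex has the same depth on all of
   them ([prefs]), and agreement passes to smaller depths ([prefn]). *)
have pref u v i j : i <= d -> j <= d ->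
    nth root (root :: P u) i = nth root (root :: P v) j -> take i (P u) = take j (P v).
  have [pu uu lu su] := HP u; have [pv uv lv sv] := HP v.
  move=> id jd e; apply: (@acyclic_uniq_path _ root (nth root (root :: P u) i)) => //.
  - by rewrite /walk take_path // last_take_nth ?su ?eqxx.
  - by rewrite /walk take_path // last_take_nth ?sv // e eqxx.
  - by rewrite -[_ :: _]/(take i.+1 (root :: P u)) take_uniq.
  - by rewrite -[_ :: _]/(take j.+1 (root :: P v)) take_uniq.
have prefs u v i j : i <= d -> j <= d ->
    nth root (root :: P u) i = nth root (root :: P v) j -> i = j.
  have [_ _ _ su] := HP u; have [_ _ _ sv] := HP v.
  by move=> id jd /(pref _ _ _ _ id jd)/(congr1 size); rewrite !size_takel ?su ?sv.
have prefn u v i k : k <= i -> i <= d ->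
    nth root (root :: P u) i = nth root (root :: P v) i ->
    nth root (root :: P u) k = nth root (root :: P v) k.
  move=> ki id /(pref _ _ _ _ id id) e.
  rewrite -(@nth_take i.+1 _ root k) // -[RHS](@nth_take i.+1 _ root k) //=.
  by rewrite e.
pose anc l u := nth root (root :: P u) (d - l).
have anc0 u : anc 0 u = leaf u.
  by have [_ _ <- su] := HP u; rewrite /anc subn0 (last_nth root) su.
have [|||lev ulev levP] := @nested_ultrametric G T d anc.
- by move=> u v; rewrite !anc0; apply: leaf_inj.
- by move=> u v; rewrite /anc subnn.
- by move=> l u v ld; apply: prefn; rewrite ?leq_subr // leq_sub2l.
have [lev0 levC _ levd] := ulev.
(* Level [l.+1] is the index [l] of the signature; level 0 and levels above [d] default to
   [false]. *)
pose S i j n := if n is l.+1 then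
  (if insub l is Some l' then (i, j, l' : 'I_d) \in sig else false) else false.
exists lev, c, S; split=> // [i j [|l] //= | u v uv].
  by case: insubP => // l' _ _; rewrite sig_sym.
case E: (lev u v) (levd u v) => [|l] ld.
  by move/eqP: E; rewrite lev0 (negPf uv).
rewrite /S insubT; apply: adjP => //=.
have [pu uu lu su] := HP u; have [pv uv' lv sv] := HP v.
have meet : anc l.+1 u = anc l.+1 v by apply/eqP; rewrite -levP // E.
have apart : anc l u != anc l v by rewrite -levP ?E ?ltnn // ltnW.
(* [k] is the depth of the lowest common ancestor [w]. *)
set k := d - l.+1; have kd : k <= d by lia.
set w := anc l.+1 u in meet.
have wk u' : anc l.+1 u' = last root (take k (P u')).
  by have [_ _ _ s'] := HP u'; rewrite last_take_nth ?s'.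
have pw u' : walk (anc l.+1 u') (leaf u') (drop k (P u')).
  have [p' _ l' _] := HP u'.
  move: p' l'; rewrite -{1 2}(cat_take_drop k (P u')) cat_path last_cat -wk.
  by rewrite /walk => /andP[_ ->] ->; rewrite eqxx.
have sd u' : size (drop k (P u')) = l.+1.
  by have [_ _ _ s'] := HP u'; rewrite size_drop s' /k; lia.
have mem_d u' x : x \in drop k (P u') ->
    exists2 i, k < i <= d & x = nth root (root :: P u') i.
  case/(nthP root) => i; rewrite sd nth_drop => il <-.
  by exists (k + i).+1; rewrite //= /k; lia.
(* [q] climbs from [leaf u] to [w] and descends to [leaf v]; once it is free of repetitions, its
   length is the distance. *)
pose q := rev (belast w (drop k (P u))) ++ drop k (P v).
have sq : size q = 2 * l.+1 by rewrite size_cat size_rev size_belast !sd; lia.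
rewrite -sq; apply: uniq_walk_distance => //.
  apply: (@walk_cat _ _ w); first exact: (walk_rev (pw u)).
  by rewrite meet.
have uw u' : uniq (anc l.+1 u' :: drop k (P u')).
  have [_ U' _ s'] := HP u'.
  have ks : k < size (root :: P u') by rewrite /= s' /k; lia.
  have -> : anc l.+1 u' :: drop k (P u') = drop k (root :: P u').
    by rewrite (drop_nth root ks).
  exact: drop_uniq.
have -> : leaf u :: q = rev (w :: drop k (P u)) ++ drop k (P v).
  rewrite /q -cat_cons; congr (_ ++ _).
  have /andP[_ /eqP <-] := pw u; rewrite -rev_rcons -lastI //.
have := uw v; rewrite cons_uniq => /andP[wv uqv].
rewrite cat_uniq rev_uniq uw uqv andbT.
(* A vertex on both branches below [w] would have the same depth [j > k] on both, so the ancestors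
   at height [l] would agree, against [apart]. *)
apply/hasPn => x xv; rewrite mem_rev inE negb_or.
have [j /andP[kj jd] xj] := mem_d _ _ xv.
apply/andP; split; first by rewrite meet; apply: contraTneq xv => ->.
apply/negP => /mem_d[i /andP[ki id] xi]; rewrite xj in xi.
have eij := prefs _ _ _ _ jd id xi; rewrite -eij in xi.
case/eqP: apart; rewrite /anc; apply/esym/(prefn _ _ j) => //; rewrite /k in kj; lia.
Qed.

(** * Sequences of subset complementations *)

Lemma isomorphic_sym (G H : sgraph) : isomorphic G H -> isomorphic H G.
Proof.
case=> f [g fK gK] fadj; exists g; first by exists f.
by move=> x y; rewrite -fadj !gK.
Qed.

Lemma isomorphic_trans (G H K : sgraph) :
  isomorphic G H -> isomorphic H K -> isomorphic G K.
Proof.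
move=> [f bf fadj] [g bg gadj]; exists (g \o f); first exact: bij_comp.
by move=> x y; rewrite /= gadj fadj.
Qed.

Lemma SC_isomorphic (n : nat) (G H : sgraph) : isomorphic G H -> SC n H -> SC n G.
Proof.
move=> GH scH; case: n H / scH GH => [H HK | n p Gs X H p0 scG HX] GH.
  by apply: SC_base; apply: isomorphic_trans HK.
by apply: (SC_step p0 scG); apply: isomorphic_trans HX.
Qed.

(** Off the diagonal, complementation is addition over GF(2), so that complementing twice on the
    same set cancels. *)
Lemma compl_adjE (G : sgraph) (X : {set G}) (x y : G) :
  compl_adj X x y = (x != y) && (adj x y (+) ((x \in X) && (y \in X))).
Proof.
rewrite /compl_adj subUset !sub1set.
by case: (x == y) (adj x y) (x \in X) (y \in X) => [] [] [] [].
Qed.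

(** [G] is isomorphic to a disjoint union with one component. *)
Lemma SC_subset_compl (n : nat) (G : sgraph) (X : {set G}) :
  SC n G -> SC n.+1 (subset_compl X).
Proof.
move=> scG; pose Gs := fun _ : 'I_1 => G.
pose g (x : dunion Gs) : G := tagged x.
have bg : bijective g.
  exists (fun x => Tagged Gs (x : Gs ord0)) => // -[i x]; rewrite /g /=.
  by rewrite (ord1 i).
apply: (@SC_step n 1 Gs (g @^-1: X)) => //; apply: isomorphic_sym.
exists g => // x y; rewrite -[LHS]/(compl_adj X (g x) (g y)).
rewrite -[RHS]/(compl_adj (g @^-1: X) x y) !compl_adjE !inE (bij_eq bg).
congr (_ && (_ (+) _)); case: x y => [i x] [j y]; rewrite /= /dunion_adj /=.
by case: _ / (etrans (ord1 i) (esym (ord1 j))) y => y; rewrite eqxx tagged_asE.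
Qed.

(** The total change to the pair [x], [y] after complementing on all the sets of [Xs] in turn. *)
Definition flip_adj (T : finType) (Xs : seq {set T}) (x y : T) : bool :=
  odd (count (fun X : {set T} => (x \in X) && (y \in X)) Xs).

Lemma flip_adj_cat (T : finType) (Xs Ys : seq {set T}) (x y : T) :
  flip_adj (Xs ++ Ys) x y = flip_adj Xs x y (+) flip_adj Ys x y.
Proof. by rewrite /flip_adj count_cat oddD. Qed.

(* The first complementation is the one that glues the G_i, so a nonempty list
   of sets costs exactly its length. *)
Lemma SC_flips (n p : nat) (Gs : 'I_p -> sgraph) (Xs : seq {set dunion Gs})
    (G : sgraph) (g : dunion Gs -> G) :
  0 < p -> (forall i, SC n (Gs i)) -> 0 < size Xs -> bijective g ->
  (forall x y, x != y -> adj (g x) (g y) = adj x y (+) flip_adj Xs x y) ->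
  SC (n + size Xs) G.
Proof.
move=> p0 scG + bg; elim/last_ind: Xs G g bg => // Xs X IH G g bg _ gadj.
have flipE x y : flip_adj (rcons Xs X) x y =
    flip_adj Xs x y (+) ((x \in X) && (y \in X)).
  by rewrite -cats1 flip_adj_cat /flip_adj /= addn0; case: (_ && _).
rewrite size_rcons addnS.
case: (posnP (size Xs)) => [/size0nil Xs0 | Xs_gt0].
  subst Xs; rewrite addn0.
  apply: (@SC_step n p Gs X) => //; apply: isomorphic_sym; exists g => // x y.
  rewrite /= compl_adjE; case: (eqVneq x y) => [-> | xy]; first by rewrite adj_irrefl.
  by rewrite gadj // flipE.
have [g' gK g'K] := bg.
(* Undoing the last flip on [G] leaves a graph built by [Xs] alone; flipping [Y] again restores
   [G]. *)
pose Y := g' @^-1: X.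
have scH : SC (n + size Xs) (subset_compl Y).
  apply: (IH (subset_compl Y) g) => // x y xy.
  rewrite /= compl_adjE (bij_eq bg) xy !inE !gK.
  by rewrite gadj // flipE /= -addbA -addbA addbb addbF.
apply: SC_isomorphic (SC_subset_compl (Y : {set subset_compl Y}) scH).
exists id => [|x y]; first by exists id.
rewrite /= compl_adjE /= compl_adjE.
by case: eqVneq => [-> | _] /=; rewrite ?adj_irrefl // -addbA addbb addbF.
Qed.


Lemma flip_adj_map (T U : finType) (f : U -> {set T}) (D : pred U) (x y : T) :
  flip_adj [seq f u | u <- enum D] x y
  = odd #|[pred u | D u && ((x \in f u) && (y \in f u))]|.
Proof.
rewrite /flip_adj count_map -size_filter cardE; congr (odd (size _)).
rewrite /enum_mem -filter_predI; apply: eq_filter => u /=.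
by rewrite !inE andbC.
Qed.

(** A set of two colours flips one off-diagonal pair and two diagonal entries; a singleton flips one
    diagonal entry. Diagonal entries matter, as they govern vertices of equal colour. *)
Lemma symmetric_as_flips (m : nat) (S : rel 'I_m) : symmetric S ->
  exists2 Ys : seq {set 'I_m}, size Ys = m * (m + 1) &
    forall i j, flip_adj Ys i j = S i j.
Proof.
move=> symS.
(* A is correct off the diagonal; B repairs the diagonal. *)
pose A := [seq [set p.1; p.2] |
  p <- enum (fun p : 'I_m * 'I_m => (p.1 < p.2) && S p.1 p.2)].
pose D i := S i i (+) flip_adj A i i.
pose B := [seq [set i] | i <- enum D].
have Bij i j : flip_adj B i j = (i == j) && D i.
  rewrite flip_adj_map; case: (eqVneq i j) => [<- | ij] /=.
    case Di: (D i); last rewrite eq_card0 //.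
      rewrite (eq_card1 (x := i)) // => k; rewrite !inE andbb eq_sym.
      by case: eqVneq => [->|]; rewrite ?Di ?andbF.
    by move=> k; rewrite !inE andbb eq_sym; case: eqVneq => [->|]; rewrite ?Di ?andbF.
  rewrite eq_card0 // => k; rewrite !inE; apply/negP => /and3P[_ /eqP ik /eqP jk].
  by rewrite ik jk eqxx in ij.
have Aij i j : i != j -> flip_adj A i j = S i j.
  wlog ij : i j / i < j => [hw|] nij.
    case: (ltngtP i j) => [ij | ji | /val_inj e]; first exact: hw.
      rewrite symS -hw 1?eq_sym // /flip_adj; congr odd; apply: eq_count => X.
      by rewrite andbC.
    by rewrite e eqxx in nij.
  have mem2 (p : 'I_m * 'I_m) :
      [&& p.1 < p.2, i \in [set p.1; p.2] & j \in [set p.1; p.2]] = (p == (i, j)).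
    case: p => a b; rewrite !inE xpair_eqE /=; apply/and3P/andP; last first.
      by case=> /eqP -> /eqP ->; rewrite ij !eqxx orbT.
    by rewrite -!val_eqE /= => -[ab iab jab]; split; lia.
  rewrite flip_adj_map; case Sij: (S i j).
    rewrite (eq_card1 (x := (i, j))) // => p; rewrite !inE -mem2 !inE.
    case: p => a b /=; move: (mem2 (a, b)); rewrite !inE /=.
    case: (a < b) => //= ->; case: eqP => [[-> ->]|]; by rewrite ?Sij ?andbF.
  rewrite eq_card0 // => p; rewrite !inE.
  case: p => a b /=; move: (mem2 (a, b)); rewrite !inE /=.
  case: (a < b) => //= ->; case: eqP => [[-> ->]|]; by rewrite ?Sij ?andbF.
have sAB : size (A ++ B) <= m * (m + 1).
  rewrite size_cat !size_map -!cardE mulnDr muln1.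
  apply: leq_add; last by apply: leq_trans (max_card _) _; rewrite card_ord.
  by apply: leq_trans (max_card _) _; rewrite card_prod card_ord.
(* Empty sets flip nothing; they pad the list to the exact length that the index of [SC] demands. *)
exists ((A ++ B) ++ nseq (m * (m + 1) - size (A ++ B)) set0).
  by rewrite [LHS]size_cat size_nseq subnKC.
move=> i j; rewrite !flip_adj_cat {3}/flip_adj count_nseq inE mul0n addbF.
rewrite Bij; case: (eqVneq i j) => [<- | ij] /=; last by rewrite addbF Aij.
by rewrite /D addbCA addbb addbF.
Qed.

(** * From ultrametrics to subset complementations *)

Section InducedXor.
Variables (G : sgraph) (A : {set G}) (F : rel G).
Hypothesis symF : symmetric F.

(** A component as it must look before the flips realising [F]. The conjunct [x != y] prevents loops
    where [F] holds on the diagonal. *)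
Definition induced_xor_adj : rel {x | x \in A} := fun x y =>
  (x != y) && (adj (val x) (val y) (+) F (val x) (val y)).

Lemma induced_xor_adj_sym : symmetric induced_xor_adj.
Proof. by move=> x y; rewrite /induced_xor_adj eq_sym adj_sym symF. Qed.

Lemma induced_xor_adj_irrefl : irreflexive induced_xor_adj.
Proof. by move=> x; rewrite /induced_xor_adj eqxx. Qed.

Definition induced_xor : sgraph :=
  SGraph induced_xor_adj_sym induced_xor_adj_irrefl.
End InducedXor.

(* Flipping by the top-level relation S(-, -, d+1) also disturbs the pairs of
   lower level; this is absorbed by replacing S with S xor S(-, -, d+1) there. *)
Lemma level_model_SC (d m : nat) (G : sgraph) :
  (exists x : G, true) -> level_model d m G -> SC (d * m * (m + 1)) G.
Proof.
elim: d G => [|d IH] G [x0 _] [lev [c [S [[lev0 levC levU levd] symS adjS]]]].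
  have eqx (x y : G) : x = y by apply/eqP; rewrite -lev0 -leqn0.
  apply: SC_base; exists (fun _ => tt) => [|x y]; last first.
    by rewrite (eqx x y) !adj_irrefl.
  by exists (fun _ => x0) => [x | []].
pose ball x := [set y | lev x y <= d].
have ballP x y : (ball x == ball y) = (lev x y <= d).
  apply/eqP/idP => [e | xy].
    have : y \in ball y by rewrite inE (eqP (etrans (lev0 y y) (eqxx y))).
    by rewrite -e inE.
  apply/setP => z; rewrite !inE; apply/idP/idP => le.
    by apply: leq_trans (levU _ x _) _; rewrite geq_max (levC y x) xy.
  by apply: leq_trans (levU _ y _) _; rewrite geq_max xy.
(* The balls of radius [d] partition the vertices; they are the components to be glued. *)
pose P := [set ball x | x in G].
have memP (i : 'I_#|P|) x : x \in enum_val i -> enum_val i = ball x.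
  have /imsetP[z _ ->] := enum_valP i; rewrite inE => zx.
  by apply/eqP; rewrite ballP.
pose F x y := S (c x) (c y) d.+1.
have symF : symmetric F by move=> x y; rewrite /F symS.
pose Gs (i : 'I_#|P|) := induced_xor (enum_val i) symF.
pose g (x : dunion Gs) : G := val (tagged x).
have gP x : enum_val (tag x) = ball (g x).
  by apply: memP; rewrite /g; case: x => i [].
have bg : bijective g.
  have g_inj : injective g.
    move=> x y e; have /enum_val_inj : enum_val (tag x) = enum_val (tag y).
      by rewrite !gP e.
    case: x y e => [i x] [j y]; rewrite /g /= => e eij.
    by subst j; congr Tagged; apply: val_inj.
  have /fin_all_exists[h hK] y : exists x, g x = y.
    have yP : ball y \in P by apply: imset_f.
    have yy : y \in enum_val (enum_rank_in yP (ball y)).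
      by rewrite enum_rankK_in // inE (eqP (etrans (lev0 y y) (eqxx y))).
    by exists (Tagged Gs (exist _ y yy : Gs _)).
  by exists h => // x; apply: g_inj; rewrite hK.
have [Ys sYs YsP] :=
  @symmetric_as_flips m (fun i j => S i j d.+1) (fun i j => symS i j _).
(* Sets of colours are pulled back to sets of vertices, so the flips realise [F]. *)
pose Xs := [seq [set x : dunion Gs | c (g x) \in Y] | Y : {set 'I_m} <- Ys].
have sXs : size Xs = m * (m + 1) by rewrite size_map.
have XsP x y : flip_adj Xs x y = F (g x) (g y).
  rewrite /F -YsP /flip_adj count_map; congr odd; apply: eq_count => Y /=.
  by rewrite !inE.
have -> : d.+1 * m * (m + 1) = d * m * (m + 1) + size Xs by rewrite sXs; lia.
apply: (SC_flips (g := g)) => //.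
- by apply/card_gt0P; exists (ball x0); apply: imset_f.
- move=> i; apply: IH.
    have /imsetP[z _ e] := enum_valP i.
    have zz : z \in enum_val i by rewrite e inE (eqP (etrans (lev0 z z) (eqxx z))).
    by exists (exist _ z zz).
  exists (fun x y => lev (val x) (val y)), (fun x => c (val x)).
  exists (fun a b l => S a b l (+) S a b d.+1); split.
  + split=> [x y | x y | x y z | x y]; rewrite ?lev0 //.
    by rewrite -ballP -!(memP i) ?eqxx //; apply: (valP (_ : {x | x \in enum_val i})).
  + by move=> a b l; rewrite !(symS a b).
  move=> x y xy; rewrite /= /induced_xor_adj xy /= adjS //.
(* The list is nonempty: [m] is positive because [x0] has a colour. *)
- by rewrite sXs muln_gt0 addn1 andbT; apply: leq_ltn_trans (ltn_ord (c x0)).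
move=> x y xy; rewrite XsP.
have gxy : g x != g y by rewrite (bij_eq bg).
(* Across components the level is exactly [d.+1], where adjacency is [F]; inside one, the flips
   cancel the [F] built into it. *)
rewrite /= /dunion_adj; case: (eqVneq (tag x) (tag y)) => [e | ne] /=; last first.
  rewrite adjS // /F; congr S; apply/eqP; rewrite eqn_leq levd /= ltnNge.
  rewrite -ballP -!gP; apply: contraNN ne => /eqP e; exact/eqP/enum_val_inj.
case: x y e xy gxy {XsP} => [i x] [j y] /= e; subst j.
rewrite tagged_asE /induced_xor_adj /g /= => xy gxy.
have -> : x != y by rewrite -val_eqE.
by rewrite /= -addbA addbb addbF.
Qed.

(** * From subset complementations to ultrametrics *)

(* [b x n] records whether [x] is complemented at step [n]; two vertices meet at
   step [lev x y], and only the steps from then on affect their adjacency. *)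
Lemma SC_bits (k : nat) (G : sgraph) : SC k G ->
  (exists x : G, true) /\
  exists (lev : G -> G -> nat) (b : G -> nat -> bool),
    ultrametric k lev /\ forall x y, x != y ->
      adj x y = odd (\sum_(lev x y <= n < k.+1) (b x n && b y n)).
Proof.
elim=> {k G} [G [f bf _] | k p Gs X G p0 _ IH [f bf fadj]].
  have eqx (x y : G) : x = y by apply: (bij_inj bf); case: (f x) (f y) => [] [].
  split; first by case: bf => h _ _; exists (h tt).
  exists (fun _ _ => 0), (fun _ _ => false); split; last first.
    by move=> x y; rewrite (eqx x y) eqxx.
  by split=> // x y; rewrite (eqx x y) !eqxx.
split.
  case: bf => h _ _; have [[x _] _] := IH (Ordinal p0).
  by exists (h (Tagged Gs x)).
have {}IH i := proj2 (IH i).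
have [levs {}IH] := fin_all_exists IH.
have [bs {}IH] := fin_all_exists IH.
pose lev' (x y : dunion Gs) :=
  if tag x == tag y then levs (tag x) (tagged x) (tagged_as x y) else k.+1.
pose b' (x : dunion Gs) n := if n == k.+1 then x \in X else bs (tag x) (tagged x) n.
have ult : ultrametric k.+1 lev'.
  split=> [[i x] [j y] | [i x] [j y] | [i x] [j y] [l z] | [i x] [j y]];
    rewrite /lev' /=.
  - have [[lev0 _ _ _] _] := IH i.
    rewrite -tag_eqE /tag_eq /=; case: (eqVneq i j) y => [<- y | //].
    by rewrite !tagged_asE lev0.
  - rewrite [j == i]eq_sym; case: (eqVneq i j) y => [<- y | //].
    by have [[_ levC _ _] _] := IH i; rewrite !tagged_asE.
  - have [[_ _ levU levd] _] := IH i; have ld x' y' := leq_trans (levd x' y') (leqnSn k).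
    case: (eqVneq i j) y => [<- y | ij y].
      case: (eqVneq i l) z => [<- z | il z]; first by rewrite !tagged_asE.
      by rewrite leq_maxr.
    by rewrite leq_max; case: eqP => _; rewrite ?leqnn // ld.
  by have [[_ _ _ levd] _] := IH i; case: eqP => // _; rewrite leqW.
have adj' x y : x != y ->
    compl_adj X x y = odd (\sum_(lev' x y <= n < k.+2) (b' x n && b' y n)).
  move=> xy; rewrite compl_adjE xy /=.
  have [_ _ _ lev'd] := ult.
  (* The top summand is the new complementation. What remains is an empty sum for vertices of
     different components, and the old sum otherwise. *)
  rewrite big_nat_recr //= oddD oddb.
  have bX z : b' z k.+1 = (z \in X) by rewrite /b' eqxx.
  rewrite !bX; congr (_ (+) _).
  case: x y xy => [i x] [j y]; rewrite -tag_eqE /tag_eq /dunion_adj /lev' /=.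
  case: (eqVneq i j) y => [<- y | ij y] /=; last by rewrite big_geq.
  have [_ adji] := IH i; rewrite !tagged_asE /= => xy; rewrite adji //; congr odd.
  by apply: eq_big_nat => n /andP[_ nk]; rewrite /b' ltn_eqF.
exists (fun x y => lev' (f x) (f y)), (fun x => b' (f x)); split.
  have [lev0 levC levU levd] := ult.
  by split=> // x y; rewrite lev0 (bij_eq bf).
by move=> x y xy; rewrite -fadj -adj' // (bij_eq bf).
Qed.

Lemma SC_level_model (k : nat) (G : sgraph) : SC k G -> level_model k (2 ^ k) G.
Proof.
case/SC_bits => _ [lev [b [ult adjb]]].
have cardB : #|{: k.-tuple bool}| = 2 ^ k by rewrite card_tuple card_bool.
(* A colour encodes the bits of the steps 1 to [k], so step [n] sits at index [n.-1]. *)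
pose bit (a : 'I_(2 ^ k)) n :=
  nth false (enum_val (cast_ord (esym cardB) a) : k.-tuple bool) n.-1.
pose c x := cast_ord cardB (enum_rank [tuple b x i.+1 | i < k]).
have bitc x n : 0 < n <= k -> bit (c x) n = b x n.
  case: n => // n nk; rewrite /bit /c cast_ordK enum_rankK /=.
  by rewrite (nth_map (Ordinal nk)) ?size_enum_ord // nth_enum_ord.
exists lev, c, (fun a a' l => odd (\sum_(l <= n < k.+1) (bit a n && bit a' n))).
split=> // [i j l | x y xy].
  by congr odd; apply: eq_bigr => n _; rewrite andbC.
rewrite adjb //; congr odd; apply: eq_big_nat => n /andP[ln nk].
have [lev0 _ _ _] := ult.
(* Distinct vertices have positive level, so the sum never reaches step 0, which the colour does not
   record. *)
have l0 : 0 < lev x y by rewrite lt0n lev0.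
have n0k : 0 < n <= k by rewrite (leq_trans l0 ln).
by rewrite !bitc.
Qed.

(** * The tree of balls of an ultrametric *)

Section LeveledTree.
Variables (N : finType) (h : N -> nat) (d : nat) (parent : rel N) (root : N).
Hypothesis parent_h : forall x y, parent x y -> h y = (h x).+1.
Hypothesis parent_fun : forall x y z, parent x y -> parent x z -> y = z.
Hypothesis h_le : forall x, h x <= d.
Hypothesis h_root : forall x, (h x == d) = (x == root).
Hypothesis parent_ex : forall x, h x < d -> exists y, parent x y.
Hypothesis child_ex : forall x, 0 < h x -> exists y, parent y x.

Definition leveled_adj : rel N := fun x y => parent x y || parent y x.

Lemma leveled_adj_sym : symmetric leveled_adj.
Proof. by move=> x y; rewrite /leveled_adj orbC. Qed.

Lemma leveled_adj_irrefl : irreflexive leveled_adj.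
Proof.
move=> x; rewrite /leveled_adj orbb; apply/negP => /parent_h /eqP.
by rewrite -addn1 -{1}[h x]addn0 eqn_add2l.
Qed.

Definition leveled_tree : sgraph := SGraph leveled_adj_sym leveled_adj_irrefl.

Lemma leveled_tree_is_tree : is_tree leveled_tree.
Proof.
split.
  have toroot (x : N) : connect leveled_adj x root.
    have [n] := ubnP (d - h x); elim: n x => // n IH x hx.
    case: (ltngtP (h x) d) (h_le x) => [ltx | // | hxd] _; last first.
      by have -> : x = root by apply/eqP; rewrite -h_root hxd.
    have [y xy] := parent_ex ltx.
    apply: connect_trans (connect1 _) (IH y _); first by rewrite /leveled_adj xy.
    by rewrite (parent_h xy); lia.
  move=> x y; apply: connect_trans (toroot x) _.
  by rewrite (sym_connect_sym leveled_adj_sym).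
(* The two cycle neighbours of a lowest node would both be its parent. *)
move=> c sc /andP[cc uc].
have [a0 a0c] : exists a, a \in c.
  by case: c sc {cc uc} => // a c _; exists a; rewrite mem_head.
case: (arg_minnP h a0c) => a ac amin.
(* Rotated to start at [a], the cycle has its neighbours of [a] at the two ends of the remaining
   list. *)
have [i c' ec] := rot_to ac.
have : uniq (rot i c) by rewrite rot_uniq.
have : cycle leveled_adj (rot i c) by rewrite rot_cycle.
have sc' : 2 < size (rot i c) by rewrite size_rot.
have amin' b : b \in c' -> h a <= h b.
  move=> bc'; have bc : b \in c by rewrite -(mem_rot i) ec inE bc' orbT.
  exact: amin.
rewrite {}ec in sc' *; case/lastP: c' amin' sc' => // c' e amin' sc'.
have up b : b \in rcons c' e -> leveled_adj a b -> parent a b.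
  by move=> /amin' ab /orP[// | /parent_h e2]; rewrite e2 ltnn in ab.
case: c' up sc' {amin'} => // b c' up _; rewrite rcons_cons /=.
case/andP=> ab; rewrite rcons_path last_rcons => /andP[_ ea].
case/and3P=> _ bc' _; rewrite mem_rcons inE negb_or in bc'.
case/andP: bc' => be _; case/eqP: be; apply: (@parent_fun a); apply: up => //.
- by rewrite mem_head.
- by rewrite mem_rcons mem_head.
by rewrite leveled_adj_sym.
Qed.

(** A node other than the root has exactly one parent, so its degree is 1 exactly when it has no
    child; the root has no parent, its height being maximal. *)
Lemma leveled_tree_leaf (x : N) : is_leaf (root : leveled_tree) x = (h x == 0).
Proof.
rewrite /is_leaf /degree; case: ifPn => [xroot | xroot].
  rewrite cards_eq0; move: (xroot); rewrite -h_root => /eqP hx.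
  case: (posnP (h x)) => [h0 | hpos].
    apply/eqP/setP => y; rewrite !inE; apply/negP => /orP[]/parent_h e.
      by have := h_le y; rewrite e; lia.
    by rewrite h0 in e.
  apply/negbTE/set0Pn; have [y yx] := child_ex hpos.
  by exists y; rewrite inE /= /leveled_adj yx orbT.
have hx : h x < d by rewrite ltn_neqAle h_root xroot h_le.
have [y xy] := parent_ex hx.
case: (posnP (h x)) => [h0 | hpos].
  apply/cards1P; exists y; apply/setP => z; rewrite !inE /= /leveled_adj.
  apply/orP/eqP => [[xz | /parent_h] | ->]; last by left.
    exact: parent_fun xz xy.
  by rewrite h0.
have [z zx] := child_ex hpos; apply/negbTE/negP => /cards1P[w ew].
have inw t : leveled_adj x t -> t = w.
  by move=> xt; apply/set1P; rewrite -ew inE.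
have yw : y = w by apply: inw; rewrite /leveled_adj xy.
have zw : z = w by apply: inw; rewrite /leveled_adj zx orbT.
have := parent_h zx; rewrite zw -yw (parent_h xy) => /eqP.
by rewrite ltn_eqF // leqW.
Qed.

(** A path that avoids the parent of its start can only descend: after each downward step, the
    parent is the node just left. *)
Lemma leveled_tree_down (x z : N) (p : seq N) : parent x z -> z \notin p ->
  path leveled_adj x p -> uniq (x :: p) -> h (last x p) + size p = h x.
Proof.
elim: p x z => [|y p IH] x z xz; first by rewrite addn0.
rewrite inE negb_or => /andP[zy _] /= /andP[xy pp] /andP[xp up].
case/orP: xy => [xy | yx]; first by rewrite (parent_fun xz xy) eqxx in zy.
rewrite (parent_h yx) addnS (IH y x) //.
by move: xp; rewrite inE negb_or => /andP[].
Qed.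

Lemma leveled_tree_path (p : seq N) :
  path leveled_adj root p -> uniq (root :: p) -> h (last root p) + size p = d.
Proof.
have hr : h root = d by apply/eqP; rewrite h_root.
case: p => [|y p]; first by rewrite addn0.
move=> /= /andP[/orP[/parent_h e | yr] pp] /andP[rp up].
  by have := h_le y; rewrite e hr ltnn.
rewrite addnS (leveled_tree_down yr) // -?hr ?(parent_h yr) //.
by move: rp; rewrite inE negb_or => /andP[].
Qed.
End LeveledTree.

(** * Balls tagged with their radius *)

Section BallTree.
Variables (T : finType) (d : nat) (lev : T -> T -> nat) (x0 : T).
Hypothesis ult : ultrametric d lev.

Let lev_xx x : lev x x = 0.
Proof. by case: ult => lev0 _ _ _; apply/eqP; rewrite lev0. Qed.

Let lev_sym x y : lev x y = lev y x.
Proof. by case: ult. Qed.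

Let lev_trans n y x z : lev x y <= n -> lev y z <= n -> lev x z <= n.
Proof.
case: ult => _ _ levU _ xy yz; apply: leq_trans (levU x y z) _.
by rewrite geq_max xy.
Qed.

Definition ball (l : nat) (x : T) : {set T} := [set y | lev x y <= l].

Lemma ball_eq l x y : y \in ball l x -> ball l y = ball l x.
Proof.
rewrite inE => xy; apply/setP => z; rewrite !inE; apply/idP/idP.
  exact: lev_trans.
by apply: lev_trans; rewrite lev_sym.
Qed.

(** One set can be a ball of several radii. Keeping the radius makes these distinct nodes, so that
    all leaves have depth [d]. *)
Definition is_ball (n : 'I_d.+1 * {set T}) : bool :=
  [exists x, n.2 == ball n.1 x].

Definition ball_node : finType := {n | is_ball n}.

Definition height (a : ball_node) : nat := (val a).1.
Definition block (a : ball_node) : {set T} := (val a).2.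

Lemma is_ball_ball (l : 'I_d.+1) (x : T) : is_ball (l, ball l x).
Proof. by apply/existsP; exists x. Qed.

(* Meaningful for l <= d only: inord sends any other level to 0. *)
Definition node (l : nat) (x : T) : ball_node :=
  exist is_ball _ (is_ball_ball (inord l) x).

Lemma height_node l x : l <= d -> height (node l x) = l.
Proof. by move=> ld; rewrite /height /= inordK. Qed.

Lemma block_node l x : l <= d -> block (node l x) = ball l x.
Proof. by move=> ld; rewrite /block /= inordK. Qed.

Lemma height_le a : height a <= d.
Proof. by rewrite -ltnS /height ltn_ord. Qed.

Lemma node_inj a b : height a = height b -> block a = block b -> a = b.
Proof.
case: a b => [[i A] ?] [[j B] ?]; rewrite /height /block /= => ij AB.
by apply: val_inj => /=; rewrite AB; congr pair; apply: val_inj.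
Qed.

Lemma block_ball a x : x \in block a -> a = node (height a) x.
Proof.
move=> xa; apply: node_inj; first by rewrite height_node ?height_le.
rewrite block_node ?height_le //; have /existsP[y /eqP ay] := valP a.
by move: xa; rewrite /block ay => /ball_eq <-.
Qed.

Lemma block_nonempty a : exists x, x \in block a.
Proof.
have /existsP[y /eqP ay] := valP a.
by exists y; rewrite /block ay inE lev_xx.
Qed.

Lemma block_lev a x y : x \in block a -> y \in block a -> lev x y <= height a.
Proof.
by move=> /block_ball {1}->; rewrite block_node ?height_le // inE.
Qed.

Lemma mem_block_node l x : l <= d -> x \in block (node l x).
Proof. by move=> ld; rewrite block_node // inE lev_xx. Qed.

Definition ball_parent : rel ball_node := fun a b =>
  (height b == (height a).+1) && (block a \subset block b).

Let root := node d x0.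

Lemma ball_parent_height a b : ball_parent a b -> height b = (height a).+1.
Proof. by case/andP=> /eqP. Qed.

Lemma ball_parent_fun a b c : ball_parent a b -> ball_parent a c -> b = c.
Proof.
have [x xa] := block_nonempty a.
move=> /andP[/eqP hb /subsetP/(_ x xa) xb] /andP[/eqP hc /subsetP/(_ x xa) xc].
by rewrite (block_ball xb) (block_ball xc) hb hc.
Qed.

Lemma height_root a : (height a == d) = (a == root).
Proof.
apply/eqP/eqP => [ha | ->]; last by rewrite height_node.
have [x xa] := block_nonempty a; rewrite (block_ball xa) ha.
apply: node_inj; rewrite ?height_node // !block_node //.
by apply/ball_eq; rewrite inE; case: ult.
Qed.

Lemma ball_parent_node l x : l < d -> ball_parent (node l x) (node l.+1 x).
Proof.
move=> ld; rewrite /ball_parent !height_node ?(ltnW ld) // eqxx.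
rewrite !block_node ?(ltnW ld) //; apply/subsetP => y; rewrite !inE => xy.
exact: leqW.
Qed.

Lemma ball_parent_ex a : height a < d -> exists b, ball_parent a b.
Proof.
have [x xa] := block_nonempty a; rewrite (block_ball xa) => ha.
rewrite height_node ?height_le // in ha *.
by exists (node (height a).+1 x); apply: ball_parent_node.
Qed.

Lemma ball_child_ex a : 0 < height a -> exists b, ball_parent b a.
Proof.
have [x xa] := block_nonempty a; have := height_le a; rewrite {3}(block_ball xa).
by case: (height a) => // l ld _; exists (node l x); apply: ball_parent_node.
Qed.

(** Edges join balls of consecutive radii, the smaller one contained in the larger. *)
Definition ball_tree : sgraph := leveled_tree ball_parent_height.

Lemma ball_walk_lev (a b : ball_tree) p n : walk a b p ->
  height a + height b + size p <= 2 * n ->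
  height a <= n /\ forall x y, x \in block a -> y \in block b -> lev x y <= n.
Proof.
elim: p a n => [|a' p IH] a n.
  move=> /andP[_ /eqP /= <-]; rewrite addn0 => han.
  have an : height a <= n by lia.
  by split=> // x y xa ya; apply: leq_trans (block_lev xa ya) an.
case/andP=> /= /andP[aa' pp] lp; have wp : walk a' b p by rewrite /walk pp.
case/orP: aa' => /andP[/eqP ha /subsetP sub] hn.
  have [|hn' levn] := IH a' n wp; first by rewrite ha !addSn -addnS.
  split=> [|x y xa yb]; last by apply: levn => //; apply: sub.
  by apply: ltnW; rewrite -ha.
case: n hn => [|n] hn; first by rewrite addnS muln0 in hn.
have [|hn' levn] := IH a' n wp; first by rewrite ha !addSn addnS mulnS in hn.
split=> [|x y xa yb]; first by rewrite ha.
have [x' xa'] := block_nonempty a'.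
apply: (@lev_trans _ x'); last by apply: leqW; apply: levn.
by apply: leq_trans (block_lev xa (sub _ xa')) _; rewrite ha.
Qed.

Lemma ball_walk_up l x : l <= d ->
  exists2 p, walk (node 0 x : ball_tree) (node l x) p & size p = l.
Proof.
elim: l => [_ | l IH ld]; first by exists [::]; rewrite /walk /=.
have [p wp sp] := IH (ltnW ld); exists (p ++ [:: node l.+1 x : ball_tree]).
  apply: walk_cat wp _; rewrite /walk /= eqxx !andbT /leveled_adj.
  by rewrite ball_parent_node.
by rewrite size_cat sp addn1.
Qed.

(** The previous bound on walks gives [lev x y <= n]; climbing to the common ball of radius
    [lev x y] and descending gives the converse. *)
Lemma ball_tree_distance (x y : T) n :
  at_distance (node 0 x : ball_tree) (node 0 y) (2 * n) -> lev x y = n.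
Proof.
case=> -[p wp sp] pmin; have [_ _ _ levd] := ult.
apply/eqP; rewrite eqn_leq; apply/andP; split.
  have [|_ levn] := ball_walk_lev (n := n) wp; first by rewrite !height_node ?sp.
  by apply: levn; apply: mem_block_node.
have [p1 w1 s1] := ball_walk_up x (levd x y).
have [p2 w2 s2] := ball_walk_up y (levd x y).
have e : node (lev x y) x = node (lev x y) y.
  apply: node_inj; rewrite ?height_node // !block_node //.
  by apply/esym/ball_eq; rewrite inE.
rewrite -e in w2; have := pmin _ (walk_cat w1 (walk_rev w2)).
by rewrite size_cat size_rev size_belast s1 s2; lia.
Qed.

Lemma ball_tree_leaf (a : ball_node) :
  is_leaf (root : ball_tree) a <-> exists x, node 0 x = a.
Proof.
rewrite (leveled_tree_leaf (d := d));
  [| exact: ball_parent_fun | exact: height_le | exact: height_root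
   | exact: ball_parent_ex | exact: ball_child_ex].
split=> [/eqP ha | [x <-]]; last by rewrite height_node.
by have [x xa] := block_nonempty a; exists x; rewrite (block_ball xa) ha.
Qed.

Lemma ball_tree_is_tree : is_tree ball_tree.
Proof.
apply: (leveled_tree_is_tree (d := d) (root := root)).
- exact: ball_parent_fun.
- exact: height_le.
- exact: height_root.
exact: ball_parent_ex.
Qed.

Lemma ball_tree_depth (p : seq ball_tree) :
  path (@adj ball_tree) root p -> uniq (root :: p) ->
  is_leaf (root : ball_tree) (last root p) -> size p = d.
Proof.
move=> pp up /ball_tree_leaf[x ex].
rewrite -[RHS](leveled_tree_path ball_parent_height ball_parent_fun height_le
  height_root pp up).
by rewrite -ex height_node.
Qed.

Lemma node0_inj : injective (node 0).
Proof.
move=> x y e; have := mem_block_node x (leq0n d).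
rewrite [X in block X]e block_node // inE leqn0; case: ult => lev0 _ _ _.
by rewrite lev0 => /eqP.
Qed.
End BallTree.

(** * From ultrametrics to tree-models, and the equivalence *)

Lemma level_model_TM (d m : nat) (G : sgraph) :
  (exists x : G, true) -> level_model d m G -> TM d m G.
Proof.
case=> x0 _ [lev [c [S [ult symS adjS]]]].
(* The successor turns an index in ['I_d] into the level it stands for. *)
pose sig := [set p : 'I_m * 'I_m * 'I_d | S p.1.1 p.1.2 p.2.+1].
constructor; apply: (@TreeModel d m G (ball_tree d lev) (node d lev d x0) sig
  (node d lev 0) c).
- exact: ball_tree_is_tree.
- exact: ball_tree_depth.
- exact: node0_inj.
- exact: ball_tree_leaf.
- by move=> i j l; rewrite !inE /= symS.
by move=> u v l uv /(ball_tree_distance ult) e; rewrite adjS // e inE.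
Qed.

Theorem theorem3p6 (C : sgraph -> Prop) :
  ((exists d m : nat, forall G, C G -> TM d m G) <->
   (exists k : nat, forall G, C G -> SC k G)) /\
  (forall (d m : nat) (G : sgraph), TM d m G -> SC (d * m * (m + 1)) G) /\
  (forall (k : nat) (G : sgraph), SC k G -> TM k (2 ^ k) G).
Proof.
have TM_SC d m G : TM d m G -> SC (d * m * (m + 1)) G.
  by move=> tm; apply: level_model_SC (TM_nonempty tm) (TM_level_model tm).
have SC_TM k G : SC k G -> TM k (2 ^ k) G.
  by move=> sc; apply: level_model_TM (proj1 (SC_bits sc)) (SC_level_model sc).
do !split=> //.
  by case=> d [m CTM]; exists (d * m * (m + 1)) => G /CTM; apply: TM_SC.
by case=> k CSC; exists k, (2 ^ k) => G /CSC; apply: SC_TM.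
Qed.
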